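(* Let $c$ be an NNF constraint and let $\kappa$ be a refinement variable that is acyclic in $c$. For every assignment $\sigma$: if $\sigma\models c$, then $\sigma\circ\hat\sigma_{c,\kappa}\models c$, where $\hat\sigma_{c,\kappa}$ is the strongest scoped solution for $\kappa$ in $c$.
   Context: **Constraints.** Refinements $r$ are formulas over sorted variables in a fixed theory; the set $R$ of refinements is taken to contain equalities and be closed under $\wedge,\vee,\exists$. Each refinement variable $\kappa$ has a list $\mathrm{args}(\kappa)=\bar x$ of typed parameters. Predicates $p ::= r\mid\kappa(\bar y)\mid p\wedge p$ (solutions below also use $\vee,\exists$ over predicates). NNF constraints $c ::= p\mid c_1\wedge c_2\mid\forall x{:}b.\,p\Rightarrow c$ ($b$ a base type; $x$ is in scope in $p$ and $c$). A conjunction in goal (leaf) position is read as a conjunction of constraints, so each goal is one refinement or one application $\kappa(\bar y)$. Constraints are closed and well-sorted (every variable, including arguments of refinement variables, is in scope with the right sort); the variables bound by $\forall$ are pairwise distinct and distinct from all parameters, and parameters of different refinement variables are distinct. $\kappa\in c$ means that $\kappa$ occurs in $c$. **Assignments.** An assignment $\sigma$ maps refinement variables to refinements; it is partial if its values are predicates, and it leaves refinement variables outside its domain unchanged. $\sigma(\kappa)$ may mention, besides $\bar x=\mathrm{args}(\kappa)$, variables that refer by name to the binders enclosing the occurrences of $\kappa$. $\sigma(\kappa(\bar y))=\sigma(\kappa)[\bar y/\bar x]$, where the substitution never captures $\bar y$ (read it as ''let $\bar x=\bar y$ in $\sigma(\kappa)$''); $\sigma$ is extended homomorphically to predicates and constraints.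 The composition is $(\sigma\circ\sigma')(\kappa)=\sigma(\sigma'(\kappa))$ for every refinement variable $\kappa$. $\sigma\models c$ means that $\sigma(c)$ contains no refinement variable, is closed and well-sorted, and is logically valid. **Acyclicity.** $\mathrm{flatten}(\mathit{true})=\emptyset$; $\mathrm{flatten}(p)=\{p\}$ for other goals; $\mathrm{flatten}(c\wedge c')=\mathrm{flatten}(c)\cup\mathrm{flatten}(c')$; $\mathrm{flatten}(\forall x{:}b.p\Rightarrow c)=\{\forall x{:}b.p\Rightarrow c'\mid c'\in\mathrm{flatten}(c)\}$. The head of a flat constraint $\forall x_1{:}b_1.p_1\Rightarrow\dots\Rightarrow\forall x_n{:}b_n.p_n\Rightarrow p$ is $p$, its body is $\{p_1,\dots,p_n\}$. $\kappa$ is acyclic in $c$ if no member of $\mathrm{flatten}(c)$ has $\kappa$ in both its head and its body. **Scope.** $\mathrm{scope}(\kappa,c_1\wedge c_2)$ is $\mathrm{scope}(\kappa,c_1)$ if $\kappa\in c_1,\kappa\notin c_2$, and $\mathrm{scope}(\kappa,c_2)$ if $\kappa\notin c_1,\kappa\in c_2$; $\mathrm{scope}(\kappa,\forall x{:}b.p\Rightarrow c')=\forall x{:}b.p\Rightarrow\mathrm{scope}(\kappa,c')$ if $\kappa\notin p$; in all other cases $\mathrm{scope}(\kappa,c)=c$. **Strongest scoped solution.** $\mathrm{sol}(\kappa,c_1\wedge c_2)=\mathrm{sol}(\kappa,c_1)\vee\mathrm{sol}(\kappa,c_2)$; $\mathrm{sol}(\kappa,\forall x{:}b.p\Rightarrow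 c)=\exists x{:}b.\,p\wedge\mathrm{sol}(\kappa,c)$; $\mathrm{sol}(\kappa,\kappa(\bar y))=\bigwedge_i x_i=y_i$ with $\bar x=\mathrm{args}(\kappa)$; $\mathrm{sol}(\kappa,p)=\mathit{false}$ for other goals. Disjuncts equal to $\mathit{false}$ are dropped, and $p\wedge\mathit{false}$, $\exists x.\mathit{false}$ are simplified to $\mathit{false}$. $\hat\sigma_{c,\kappa}=[\kappa\mapsto\lambda\bar x.\,\mathrm{sol}(\kappa,c')]$, where $\mathrm{scope}(\kappa,c)=\forall x_1{:}b_1.p_1\Rightarrow\dots\Rightarrow\forall x_n{:}b_n.p_n\Rightarrow c'$, stripping the maximal prefix of implications with $\kappa\notin p_i$. *)

(* Defs.v *)
From HB Require Import structures.
From Stdlib Require List.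
From mathcomp Require Import all_boot.

Set Implicit Arguments.
Unset Strict Implicit.
Unset Printing Implicit Defensive.

Definition var := nat.
Definition kvar := nat.

Definition update (A : Type) (f : var -> A) (x : var) (a : A) : var -> A :=
  fun y => if y == x then a else f y.

(* The entries of s are meant to have distinct names; the first one wins. *)
Definition updates (A : Type) (f : var -> A) (s : seq (var * A)) : var -> A :=
  foldr (fun xa g => update g xa.1 xa.2) f s.

(** * Many-sorted first-order logic *)

Record signature := Signature {
  base_type : eqType;
  fsym : Type;
  psym : Type;
  fdom : fsym -> seq base_type;
  fcod : fsym -> base_type;
  pdom : psym -> seq base_type }.

Inductive term (S : signature) : Type :=
| Var of var
| App of fsym S & seq (term S).

Inductive form (S : signature) : Type :=
| FTrue
| FFalse
| FPred of psym S & seq (term S)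
| FEq of term S & term S
| FNot of form S
| FAnd of form S & form S
| FOr of form S & form S
| FImp of form S & form S
| FEx of var & base_type S & form S
| FAll of var & base_type S & form S.

Arguments Var {S} x.
Arguments App {S} f ts.
Arguments FTrue {S}.
Arguments FFalse {S}.
Arguments FPred {S} P ts.

Definition ctx (S : signature) := var -> option (base_type S).
Definition empty_ctx {S : signature} : ctx S := fun=> None.
Definition ctx_params (S : signature) (G : ctx S) (xs : seq (var * base_type S)) :
    ctx S :=
  updates G [seq (xb.1, Some xb.2) | xb <- xs].

Fixpoint term_sort (S : signature) (G : ctx S) (t : term S) : option (base_type S) :=
  match t with
  | Var x => G x
  | App f ts =>
      if map (term_sort G) ts == map Some (fdom f) then Some (fcod f) else None
  end.

Fixpoint wf_form (S : signature) (G : ctx S) (r : form S) : bool :=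
  match r with
  | FTrue | FFalse => true
  | FPred P ts => map (term_sort G) ts == map Some (pdom P)
  | FEq t u => (term_sort G t != None) && (term_sort G t == term_sort G u)
  | FNot r1 => wf_form G r1
  | FAnd r1 r2 | FOr r1 r2 | FImp r1 r2 => wf_form G r1 && wf_form G r2
  | FEx x b r1 | FAll x b r1 => wf_form (update G x (Some b)) r1
  end.

(* A many-sorted structure whose carriers are subsets of one universe.
   Individual carriers may be empty; a theory (a class of structures) can rule
   this out. *)
Record structure (S : signature) := Structure {
  univ : Type;
  univ_pt : univ;
  dom : base_type S -> univ -> Prop;
  finterp : fsym S -> seq univ -> univ;
  pinterp : psym S -> seq univ -> Prop;
  dom_finterp : forall (f : fsym S) (us : seq univ),
    List.Forall2 (fun b u => dom b u) (fdom f) us ->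
    dom (fcod f) (finterp f us) }.

Definition theory (S : signature) := structure S -> Prop.

Fixpoint eval (S : signature) (M : structure S) (rho : var -> univ M)
    (t : term S) : univ M :=
  match t with
  | Var x => rho x
  | App f ts => finterp f (map (eval rho) ts)
  end.

Fixpoint holds_form (S : signature) (M : structure S) (rho : var -> univ M)
    (r : form S) : Prop :=
  match r with
  | FTrue => True
  | FFalse => False
  | FPred P ts => pinterp P (map (eval rho) ts)
  | FEq t u => eval rho t = eval rho u
  | FNot r1 => ~ holds_form rho r1
  | FAnd r1 r2 => holds_form rho r1 /\ holds_form rho r2
  | FOr r1 r2 => holds_form rho r1 \/ holds_form rho r2
  | FImp r1 r2 => holds_form rho r1 -> holds_form rho r2
  | FEx x b r1 => exists2 u, dom b u & holds_form (update rho x u) r1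
  | FAll x b r1 => forall u, dom b u -> holds_form (update rho x u) r1
  end.

(** * Refinements, predicates and constraints *)

Record refinement_set (S : signature) (R : form S -> Prop) : Prop :=
  RefinementSet {
  refinement_eq : forall x y, R (FEq (Var x) (Var y));
  refinement_and : forall r1 r2, R r1 -> R r2 -> R (FAnd r1 r2);
  refinement_or : forall r1 r2, R r1 -> R r2 -> R (FOr r1 r2);
  refinement_ex : forall x b r, R r -> R (FEx x b r) }.

(* [PLet xs ys p] is "let xs = ys in p", i.e. the capture-avoiding simultaneous
   substitution p[ys/xs], kept explicit: the ys are read outside of p, while
   the remaining names of p keep referring to the enclosing binders. *)
Inductive predicate (S : signature) : Type :=
| PRef of form S
| PApp of kvar & seq var
| PAnd of predicate S & predicate S
| POr of predicate S & predicate S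
| PEx of var & base_type S & predicate S
| PLet of seq (var * base_type S) & seq var & predicate S.

Arguments PApp {S} k ys.

Notation PTrue := (PRef FTrue).
Notation PFalse := (PRef FFalse).

(* [CAll x b p c] is "forall x:b. p => c". *)
Inductive constraint (S : signature) : Type :=
| CPred of predicate S
| CAnd of constraint S & constraint S
| CAll of var & base_type S & predicate S & constraint S.

(* Typed parameter lists of the refinement variables. *)
Definition params (S : signature) := kvar -> seq (var * base_type S).

Definition wf_params (S : signature) (args : params S) : Prop :=
  (forall k, uniq (unzip1 (args k))) /\
  (forall k k' x, k != k' ->
     x \in unzip1 (args k) -> x \notin unzip1 (args k')).

Fixpoint wf_pred (S : signature) (args : params S) (G : ctx S)
    (p : predicate S) : bool :=
  match p with
  | PRef r => wf_form G r
  | PApp k ys => map G ys == map Some (unzip2 (args k))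
  | PAnd p1 p2 | POr p1 p2 => wf_pred args G p1 && wf_pred args G p2
  | PEx x b p1 => wf_pred args (update G x (Some b)) p1
  | PLet xs ys p1 =>
      (map G ys == map Some (unzip2 xs)) && wf_pred args (ctx_params G xs) p1
  end.

Fixpoint wf_constraint (S : signature) (args : params S) (G : ctx S)
    (c : constraint S) : bool :=
  match c with
  | CPred p => wf_pred args G p
  | CAnd c1 c2 => wf_constraint args G c1 && wf_constraint args G c2
  | CAll x b p c1 =>
      let G' := update G x (Some b) in
      wf_pred args G' p && wf_constraint args G' c1
  end.

Fixpoint occurs_pred (S : signature) (k : kvar) (p : predicate S) : bool :=
  match p with
  | PRef _ => false
  | PApp k' _ => k' == k
  | PAnd p1 p2 | POr p1 p2 => occurs_pred k p1 || occurs_pred k p2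
  | PEx _ _ p1 | PLet _ _ p1 => occurs_pred k p1
  end.

Fixpoint occurs (S : signature) (k : kvar) (c : constraint S) : bool :=
  match c with
  | CPred p => occurs_pred k p
  | CAnd c1 c2 => occurs k c1 || occurs k c2
  | CAll _ _ p c1 => occurs_pred k p || occurs k c1
  end.

Fixpoint binders (S : signature) (c : constraint S) : seq var :=
  match c with
  | CPred _ => [::]
  | CAnd c1 c2 => binders c1 ++ binders c2
  | CAll x _ _ c1 => x :: binders c1
  end.

(* Hypotheses:  p ::= r | k(ys) | p /\ p. *)
Fixpoint is_hyp (S : signature) (R : form S -> Prop) (p : predicate S) : Prop :=
  match p with
  | PRef r => R r
  | PApp _ _ => True
  | PAnd p1 p2 => is_hyp R p1 /\ is_hyp R p2
  | POr _ _ | PEx _ _ _ | PLet _ _ _ => False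
  end.

(* A conjunction of goals is written with [CAnd]. *)
Definition is_goal (S : signature) (R : form S -> Prop) (p : predicate S) :
    Prop :=
  match p with
  | PRef r => R r
  | PApp _ _ => True
  | _ => False
  end.

Fixpoint is_nnf (S : signature) (R : form S -> Prop) (c : constraint S) : Prop :=
  match c with
  | CPred p => is_goal R p
  | CAnd c1 c2 => is_nnf R c1 /\ is_nnf R c2
  | CAll _ _ p c1 => is_hyp R p /\ is_nnf R c1
  end.

Record nnf_constraint (S : signature) (R : form S -> Prop) (args : params S)
    (c : constraint S) : Prop := NNFConstraint {
  nnf_grammar : is_nnf R c;
  nnf_closed : wf_constraint args empty_ctx c;
  nnf_uniq : uniq (binders c);
  nnf_fresh : forall k x, x \in binders c -> x \notin unzip1 (args k) }.

Fixpoint holds_pred (S : signature) (M : structure S)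
    (I : kvar -> seq (univ M) -> Prop) (rho : var -> univ M)
    (p : predicate S) : Prop :=
  match p with
  | PRef r => holds_form rho r
  | PApp k ys => I k (map rho ys)
  | PAnd p1 p2 => holds_pred I rho p1 /\ holds_pred I rho p2
  | POr p1 p2 => holds_pred I rho p1 \/ holds_pred I rho p2
  | PEx x b p1 => exists2 u, dom b u & holds_pred I (update rho x u) p1
  | PLet xs ys p1 =>
      holds_pred I (updates rho (zip (unzip1 xs) (map rho ys))) p1
  end.

Fixpoint holds (S : signature) (M : structure S)
    (I : kvar -> seq (univ M) -> Prop) (rho : var -> univ M)
    (c : constraint S) : Prop :=
  match c with
  | CPred p => holds_pred I rho p
  | CAnd c1 c2 => holds I rho c1 /\ holds I rho c2
  | CAll x b p c1 =>
      forall u, dom b u ->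
        holds_pred I (update rho x u) p -> holds I (update rho x u) c1
  end.

(* The interpretation [I] of refinement variables is immaterial below, where
   validity is only asserted of constraints without refinement variables. *)
Definition valid (S : signature) (T : theory S) (c : constraint S) : Prop :=
  forall (M : structure S), T M ->
  forall (I : kvar -> seq (univ M) -> Prop) (rho : var -> univ M),
    holds I rho c.

(** * Assignments *)

(* [None] outside of the domain. *)
Definition partial_assignment (S : signature) := kvar -> option (predicate S).

Definition is_assignment (S : signature) (R : form S -> Prop)
    (sigma : partial_assignment S) : Prop :=
  forall k p, sigma k = Some p -> exists2 r, R r & p = PRef r.

Fixpoint subst_pred (S : signature) (args : params S)
    (sigma : partial_assignment S) (p : predicate S) : predicate S :=
  match p with
  | PRef r => PRef r
  | PApp k ys => if sigma k is Some q then PLet (args k) ys q else PApp k ys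
  | PAnd p1 p2 => PAnd (subst_pred args sigma p1) (subst_pred args sigma p2)
  | POr p1 p2 => POr (subst_pred args sigma p1) (subst_pred args sigma p2)
  | PEx x b p1 => PEx x b (subst_pred args sigma p1)
  | PLet xs ys p1 => PLet xs ys (subst_pred args sigma p1)
  end.

Fixpoint subst (S : signature) (args : params S)
    (sigma : partial_assignment S) (c : constraint S) : constraint S :=
  match c with
  | CPred p => CPred (subst_pred args sigma p)
  | CAnd c1 c2 => CAnd (subst args sigma c1) (subst args sigma c2)
  | CAll x b p c1 =>
      CAll x b (subst_pred args sigma p) (subst args sigma c1)
  end.

Definition comp_assignment (S : signature) (args : params S)
    (sigma sigma' : partial_assignment S) : partial_assignment S :=
  fun k => if sigma' k is Some p then Some (subst_pred args sigma p)
           else sigma k.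

Definition satisfies (S : signature) (T : theory S) (args : params S)
    (sigma : partial_assignment S) (c : constraint S) : Prop :=
  [/\ forall k, ~~ occurs k (subst args sigma c),
      wf_constraint args empty_ctx (subst args sigma c)
    & valid T (subst args sigma c)].

(** * Acyclicity *)

(* [(s, p)] is the flat constraint with binders and hypotheses [s], head [p]. *)
Definition flat (S : signature) :=
  (seq (var * base_type S * predicate S) * predicate S)%type.

Definition flat_head (S : signature) (f : flat S) : predicate S := f.2.
Definition flat_body (S : signature) (f : flat S) : seq (predicate S) :=
  unzip2 f.1.

Fixpoint flatten (S : signature) (c : constraint S) : seq (flat S) :=
  match c with
  | CPred PTrue => [::]
  | CPred p => [:: ([::], p)]
  | CAnd c1 c2 => flatten c1 ++ flatten c2
  | CAll x b p c1 => [seq ((x, b, p) :: f.1, f.2) | f <- flatten c1]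
  end.

Definition acyclic (S : signature) (k : kvar) (c : constraint S) : bool :=
  all (fun f => ~~ (occurs_pred k (flat_head f) &&
                    has (occurs_pred k) (flat_body f)))
      (flatten c).

(** * Strongest scoped solution *)

Fixpoint scope (S : signature) (k : kvar) (c : constraint S) : constraint S :=
  match c with
  | CAnd c1 c2 =>
      if occurs k c1 && ~~ occurs k c2 then scope k c1
      else if ~~ occurs k c1 && occurs k c2 then scope k c2
      else c
  | CAll x b p c1 => if occurs_pred k p then c else CAll x b p (scope k c1)
  | CPred _ => c
  end.

Fixpoint strip_prefix (S : signature) (k : kvar) (c : constraint S) :
    constraint S :=
  match c with
  | CAll _ _ p c1 => if occurs_pred k p then c else strip_prefix k c1
  | _ => c
  end.

(* Connectives simplifying the literal [PFalse]. *)
Definition sor (S : signature) (p q : predicate S) : predicate S :=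
  match p, q with
  | PFalse, _ => q
  | _, PFalse => p
  | _, _ => POr p q
  end.

Definition sand (S : signature) (p q : predicate S) : predicate S :=
  if q is PFalse then PFalse else PAnd p q.

Definition sex (S : signature) (x : var) (b : base_type S) (p : predicate S) :
    predicate S :=
  if p is PFalse then PFalse else PEx x b p.

Definition eqs (S : signature) (xs ys : seq var) : predicate S :=
  foldr (fun xy q => PAnd (PRef (FEq (Var xy.1) (Var xy.2))) q) PTrue
        (zip xs ys).

Fixpoint sol (S : signature) (args : params S) (k : kvar) (c : constraint S) :
    predicate S :=
  match c with
  | CAnd c1 c2 => sor (sol args k c1) (sol args k c2)
  | CAll x b p c1 => sex x b (sand p (sol args k c1))
  | CPred (PApp k' ys) =>
      if k' == k then eqs S (unzip1 (args k)) ys else PFalse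
  | CPred _ => PFalse
  end.

Definition strongest_scoped_solution (S : signature) (args : params S)
    (c : constraint S) (k : kvar) : partial_assignment S :=
  fun k' =>
    if k' == k then Some (sol args k (strip_prefix k (scope k c))) else None.

(* Main.v *)
(* Replacing k by its strongest scoped solution q makes every goal k(ys) hold,
   since the hypotheses above that goal witness the matching disjunct of q.  A
   hypothesis q is at least as strong as sigma(k): a disjunct of q comes from a
   goal k(zs), where sigma(k) holds because sigma solves c.  To move sigma(k)
   from that goal to the hypothesis, sigma(k) must not depend on the variables
   bound inside the subconstraint c' from which q is computed.  If c' is a
   conjunction, k occurs in both conjuncts, which bind distinct variables, so
   only variables bound above c' are in scope at every occurrence of k.  If c' is
   an implication with k in its hypothesis, then by acyclicity k is not a head
   in c', so that q is false and there is nothing to show. *)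
Require Import Defs.
From mathcomp Require Import all_boot.

Set Implicit Arguments.
Unset Strict Implicit.
Unset Printing Implicit Defensive.

(** * Simultaneous updates of environments and contexts *)

Lemma updates_congr (A : Type) (f g : var -> A) (s : seq (var * A)) (y : var) :
  (y \notin unzip1 s -> f y = g y) -> updates f s y = updates g s y.
Proof.
elim: s => [|[x a] s IHs] /=; first by apply.
rewrite /update inE; case: eqP => //= _; exact: IHs.
Qed.

Lemma updates_notin (A : Type) (f : var -> A) (s : seq (var * A)) (y : var) :
  y \notin unzip1 s -> updates f s y = f y.
Proof.
elim: s => [|[x a] s IHs] //=; rewrite inE negb_or => /andP[ne_yx /IHs <-].
by rewrite /update (negbTE ne_yx).
Qed.

Lemma map_updates_zip (A : Type) (f : var -> A) (xs : seq var) (us : seq A) :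
  uniq xs -> size us = size xs -> map (updates f (zip xs us)) xs = us.
Proof.
elim: xs us => [|x xs IHxs] [|u us] //= /andP[x_xs uniq_xs] [sz].
rewrite {1}/update eqxx -[in RHS](IHxs us uniq_xs sz); congr cons.
apply/eq_in_map => y y_xs; rewrite /update; case: eqP => // eq_yx.
by rewrite -eq_yx y_xs in x_xs.
Qed.

(** * Well-sortedness and truth under a change of context or environment *)

Section Logic.
Context {S : signature}.
Implicit Types (G : ctx S) (args : params S) (x y : var) (b : base_type S).

Definition sub_ctx G G' := forall x b, G x = Some b -> G' x = Some b.

(** The sorts of a name in [G1] and [G2] may differ; the one in [G1] is kept. In this form,
    well-sortedness at two occurrences of a refinement variable is combined. *)
Definition meet_ctx G1 G2 G :=
  forall x b1 b2, G1 x = Some b1 -> G2 x = Some b2 -> G x = Some b1.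

Definition agree (U : Type) G (rho rho' : var -> U) :=
  forall x, G x != None -> rho x = rho' x.

Lemma ctx_paramsE G (xs : seq (var * base_type S)) :
  ctx_params G xs = updates G (zip (unzip1 xs) (map Some (unzip2 xs))).
Proof.
rewrite /ctx_params; congr updates.
by elim: xs => [|[x b] xs IHxs] //=; rewrite IHxs.
Qed.

Lemma unzip1_params (xs : seq (var * base_type S)) :
  unzip1 [seq (xb.1, Some xb.2) | xb <- xs] = unzip1 xs.
Proof. by rewrite /unzip1 -map_comp. Qed.

Lemma ctx_params_notin G (xs : seq (var * base_type S)) y :
  y \notin unzip1 xs -> ctx_params G xs y = G y.
Proof. by move=> y_xs; rewrite /ctx_params updates_notin ?unzip1_params. Qed.

Lemma ctx_params_congr G G' (xs : seq (var * base_type S)) y :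
  (y \notin unzip1 xs -> G y = G' y) ->
  ctx_params G xs y = ctx_params G' xs y.
Proof. by move=> eqG; apply: updates_congr; rewrite unzip1_params. Qed.

Lemma map_ctx_params G (xs : seq (var * base_type S)) :
  uniq (unzip1 xs) ->
  map (ctx_params G xs) (unzip1 xs) = map Some (unzip2 xs).
Proof.
by move=> uniq_xs; rewrite ctx_paramsE map_updates_zip // !size_map.
Qed.

Lemma sub_update G G' x b :
  sub_ctx G G' -> sub_ctx (update G x (Some b)) (update G' x (Some b)).
Proof. by move=> sG y b'; rewrite /update; case: eqP => // _ /sG. Qed.

Lemma sub_ctx_params G G' (xs : seq (var * base_type S)) :
  sub_ctx G G' -> sub_ctx (ctx_params G xs) (ctx_params G' xs).
Proof.
move=> sG y b; have [y_xs | y_xs] := boolP (y \in unzip1 xs).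
  by rewrite (ctx_params_congr (G' := G')) // y_xs.
by rewrite !ctx_params_notin //; apply: sG.
Qed.

Lemma meet_update G1 G2 G x b :
  meet_ctx G1 G2 G ->
  meet_ctx (update G1 x (Some b)) (update G2 x (Some b))
           (update G x (Some b)).
Proof. by move=> mG y b1 b2; rewrite /update; case: eqP => // _; apply: mG. Qed.

Lemma agree_sub (U : Type) G G' (rho rho' : var -> U) :
  sub_ctx G G' -> agree G' rho rho' -> agree G rho rho'.
Proof.
move=> sG eq_rho x; case Gx: (G x) => [b|] // _; apply: eq_rho.
by rewrite (sG _ _ Gx).
Qed.

Lemma agree_update (U : Type) G (rho rho' : var -> U) x b u :
  agree G rho rho' ->
  agree (update G x (Some b)) (update rho x u) (update rho' x u).
Proof.
by move=> eq_rho y; rewrite /update; case: (y =P x) => // _; exact: eq_rho.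
Qed.

Lemma agree_updates (U : Type) G (rho rho' : var -> U)
    (xs : seq (var * base_type S)) (us : seq U) :
  size us = size xs -> agree G rho rho' ->
  agree (ctx_params G xs) (updates rho (zip (unzip1 xs) us))
        (updates rho' (zip (unzip1 xs) us)).
Proof.
move=> sz eq_rho y Gy; apply: updates_congr.
rewrite unzip1_zip ?size_map ?sz // => y_xs.
by apply: eq_rho; rewrite ctx_params_notin in Gy.
Qed.

Lemma agree_map (U : Type) G (rho rho' : var -> U) ys
    (bs : seq (base_type S)) :
  agree G rho rho' -> map G ys = map Some bs -> map rho ys = map rho' ys.
Proof.
move=> eq_rho; elim: ys bs => [|y ys IHys] [|b bs] //= [Gy /IHys ->].
by rewrite eq_rho ?Gy.
Qed.

(** [term] is nested through [seq], and the automatic principle has no induction hypothesis for the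
    arguments of [App]. *)
Lemma term_list_ind (P : term S -> Prop) :
  (forall x, P (Var x)) ->
  (forall f ts, List.Forall P ts -> P (App f ts)) ->
  forall t, P t.
Proof.
move=> PVar PApp; fix IH 1 => -[x|f ts]; first exact: PVar.
by apply: PApp; elim: ts => [|t ts IHts]; constructor.
Qed.

Lemma term_sort_meet G1 G2 G t b1 b2 :
  meet_ctx G1 G2 G ->
  term_sort G1 t = Some b1 -> term_sort G2 t = Some b2 ->
  term_sort G t = Some b1.
Proof.
move=> mG; elim/term_list_ind: t b1 b2 => [x|f ts IHts] b1 b2 /=; first exact: mG.
case: eqP => // wf1 eq1; case: eqP => // wf2 _; rewrite -eq1.
suff -> : map (term_sort G) ts = map Some (fdom f) by rewrite eqxx.
elim: IHts (fdom f) wf1 wf2 => [|t {}ts IHt _ IHts] [|b bs] //=.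
by move=> [wf1 /IHts{}IHts] [wf2 /IHts->]; rewrite (IHt b b).
Qed.

Lemma terms_sort_meet G1 G2 G ts (bs : seq (base_type S)) :
  meet_ctx G1 G2 G ->
  map (term_sort G1) ts = map Some bs -> map (term_sort G2) ts = map Some bs ->
  map (term_sort G) ts = map Some bs.
Proof.
move=> mG; elim: ts bs => [|t ts IHts] [|b bs] //= [wf1 /IHts{}IHts] [wf2 /IHts->].
by rewrite (term_sort_meet mG wf1 wf2).
Qed.

(** Every free variable of such a formula is declared in both contexts, and a binder extends the two
    contexts and their meet alike. *)
Lemma wf_form_meet G1 G2 G r :
  meet_ctx G1 G2 G -> wf_form G1 r -> wf_form G2 r -> wf_form G r.
Proof.
elim: r G1 G2 G => [||P ts|t u|r IHr|r1 IH1 r2 IH2|r1 IH1 r2 IH2|r1 IH1 r2 IH2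
  |x b r IHr|x b r IHr] G1 G2 G mG //=.
- by move=> /eqP wf1 /eqP wf2; apply/eqP; apply: terms_sort_meet mG wf1 wf2.
- case t1: (term_sort G1 t) => [b1|] //= /eqP/esym u1.
  case t2: (term_sort G2 t) => [b2|] //= /eqP/esym u2.
  by rewrite (term_sort_meet mG t1 t2) (term_sort_meet mG u1 u2) eqxx.
- exact: IHr.
- by move=> /andP[? ?] /andP[? ?]; rewrite (IH1 G1 G2) // (IH2 G1 G2).
- by move=> /andP[? ?] /andP[? ?]; rewrite (IH1 G1 G2) // (IH2 G1 G2).
- by move=> /andP[? ?] /andP[? ?]; rewrite (IH1 G1 G2) // (IH2 G1 G2).
- by apply: IHr; apply: meet_update.
- by apply: IHr; apply: meet_update.
Qed.

(** A larger context is a meet of the smaller one with itself. *)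
Lemma wf_form_sub G G' r : sub_ctx G G' -> wf_form G r -> wf_form G' r.
Proof. by move=> sG wf_r; apply: (wf_form_meet _ wf_r wf_r) => x b b2 /sG. Qed.

Lemma map_ctx_sub G G' ys (bs : seq (base_type S)) :
  sub_ctx G G' -> map G ys = map Some bs -> map G' ys = map Some bs.
Proof.
by move=> sG; elim: ys bs => [|y ys IHys] [|b bs] //= [/sG-> /IHys->].
Qed.

Lemma wf_pred_sub args G G' p :
  sub_ctx G G' -> wf_pred args G p -> wf_pred args G' p.
Proof.
elim: p G G' => [r|k ys|p1 IH1 p2 IH2|p1 IH1 p2 IH2|x b p IHp|xs ys p IHp] G G' sG /=.
- exact: wf_form_sub.
- by move=> /eqP wf_ys; rewrite (map_ctx_sub sG wf_ys).
- by move=> /andP[? ?]; rewrite (IH1 G) // (IH2 G).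
- by move=> /andP[? ?]; rewrite (IH1 G) // (IH2 G).
- by apply: IHp; apply: sub_update.
- move=> /andP[/eqP wf_ys wf_p]; rewrite (map_ctx_sub sG wf_ys) eqxx.
  by apply: IHp wf_p; apply: sub_ctx_params.
Qed.

Section Semantics.
Variable M : structure S.
Implicit Types (rho : var -> univ M) (I : kvar -> seq (univ M) -> Prop).

Lemma eval_agree G rho rho' t :
  agree G rho rho' -> term_sort G t != None -> eval rho t = eval rho' t.
Proof.
move=> eq_rho; elim/term_list_ind: t => [x|f ts IHts] /=; first exact: eq_rho.
case: ifP => // /eqP wf_ts _; congr finterp.
elim: IHts (fdom f) wf_ts => [|t {}ts IHt _ IHts] [|b bs] //= [wf_t /IHts->].
by rewrite IHt ?wf_t.
Qed.

Lemma evals_agree G rho rho' ts (bs : seq (base_type S)) :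
  agree G rho rho' -> map (term_sort G) ts = map Some bs ->
  map (eval rho) ts = map (eval rho') ts.
Proof.
move=> eq_rho; elim: ts bs => [|t ts IHts] [|b bs] //= [wf_t /IHts->].
by rewrite (eval_agree eq_rho) // wf_t.
Qed.

Lemma holds_form_agree G rho rho' r :
  agree G rho rho' -> wf_form G r -> (holds_form rho r <-> holds_form rho' r).
Proof.
elim: r G rho rho' => [||P ts|t u|r IHr|r1 IH1 r2 IH2|r1 IH1 r2 IH2|r1 IH1 r2 IH2
  |x b r IHr|x b r IHr] G rho rho' eq_rho //=.
- by move=> /eqP wf_ts; rewrite (evals_agree eq_rho wf_ts).
- move=> /andP[wf_t /eqP eq_tu].
  by rewrite !(eval_agree (t := _) eq_rho) // -eq_tu.
- by move=> /(IHr _ _ _ eq_rho)->.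
- by move=> /andP[/(IH1 _ _ _ eq_rho)-> /(IH2 _ _ _ eq_rho)->].
- by move=> /andP[/(IH1 _ _ _ eq_rho)-> /(IH2 _ _ _ eq_rho)->].
- by move=> /andP[/(IH1 _ _ _ eq_rho)-> /(IH2 _ _ _ eq_rho)->].
- move=> wf_r; have eq_r u := IHr _ _ _ (agree_update (b := b) u eq_rho) wf_r.
  by split=> -[u bu /eq_r]; exists u.
- move=> wf_r; have eq_r u := IHr _ _ _ (agree_update (b := b) u eq_rho) wf_r.
  by split=> hr u /hr/eq_r.
Qed.

Lemma holds_pred_agree args G I rho rho' p :
  agree G rho rho' -> wf_pred args G p ->
  (holds_pred I rho p <-> holds_pred I rho' p).
Proof.
elim: p G rho rho' => [r|k ys|p1 IH1 p2 IH2|p1 IH1 p2 IH2|x b p IHp|xs ys p IHp]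
  G rho rho' eq_rho /=.
- exact: holds_form_agree.
- by move=> /eqP wf_ys; rewrite (agree_map eq_rho wf_ys).
- by move=> /andP[/(IH1 _ _ _ eq_rho)-> /(IH2 _ _ _ eq_rho)->].
- by move=> /andP[/(IH1 _ _ _ eq_rho)-> /(IH2 _ _ _ eq_rho)->].
- move=> wf_p; have eq_p u := IHp _ _ _ (agree_update (b := b) u eq_rho) wf_p.
  by split=> -[u bu /eq_p]; exists u.
- move=> /andP[/eqP wf_ys wf_p]; rewrite (agree_map eq_rho wf_ys).
  apply: IHp wf_p; apply: agree_updates eq_rho.
  by rewrite size_map -[LHS](size_map G) wf_ys !size_map.
Qed.

End Semantics.
End Logic.

(** * Refinement variables under substitution *)

Section Substitution.
Context {S : signature}.
Implicit Types (G : ctx S) (args : params S) (sigma : partial_assignment S).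
Implicit Types (k : kvar) (p q : predicate S) (c : constraint S).

Lemma eq_subst_pred args sigma sigma' p :
  (forall k, occurs_pred k p -> sigma k = sigma' k) ->
  subst_pred args sigma p = subst_pred args sigma' p.
Proof.
elim: p => [r|k ys|p1 IH1 p2 IH2|p1 IH1 p2 IH2|x b p IHp|xs ys p IHp] //= eq_s.
- by rewrite eq_s.
- by rewrite IH1 ?IH2 // => k kp; apply: eq_s; rewrite kp ?orbT.
- by rewrite IH1 ?IH2 // => k kp; apply: eq_s; rewrite kp ?orbT.
- by rewrite IHp.
- by rewrite IHp.
Qed.

Lemma eq_subst args sigma sigma' c :
  (forall k, occurs k c -> sigma k = sigma' k) ->
  subst args sigma c = subst args sigma' c.
Proof.
elim: c => [p|c1 IH1 c2 IH2|x b p c IHc] /= eq_s.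
- by rewrite (eq_subst_pred _ eq_s).
- by rewrite IH1 ?IH2 // => k kc; apply: eq_s; rewrite kc ?orbT.
- rewrite IHc; last by move=> k kc; apply: eq_s; rewrite kc orbT.
  by rewrite (@eq_subst_pred _ _ sigma') // => k kp; apply: eq_s; rewrite kp.
Qed.

Lemma occurs_pred_subst args sigma k p :
  occurs_pred k (subst_pred args sigma p) ->
  exists2 k', occurs_pred k' p &
    if sigma k' is Some q then occurs_pred k q else k' == k.
Proof.
elim: p => [r|k' ys|p1 IH1 p2 IH2|p1 IH1 p2 IH2|x b p IHp|xs ys p IHp] //=.
- by move=> kp; exists k' => //; case: (sigma k') kp.
- by case/orP=> [/IH1|/IH2] [k' k'p Hk']; exists k'; rewrite // k'p ?orbT.
- by case/orP=> [/IH1|/IH2] [k' k'p Hk']; exists k'; rewrite // k'p ?orbT.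
Qed.

Lemma occurs_subst args sigma k c :
  occurs k (subst args sigma c) ->
  exists2 k', occurs k' c &
    if sigma k' is Some q then occurs_pred k q else k' == k.
Proof.
elim: c => [p|c1 IH1 c2 IH2|x b p c IHc] /=.
- exact: occurs_pred_subst.
- by case/orP=> [/IH1|/IH2] [k' k'c Hk']; exists k'; rewrite // k'c ?orbT.
- case/orP=> [/occurs_pred_subst|/IHc] [k' k'c Hk'];
  by exists k'; rewrite // k'c ?orbT.
Qed.

Lemma occurs_pred_subst_None args sigma k p :
  sigma k = None -> occurs_pred k p -> occurs_pred k (subst_pred args sigma p).
Proof.
move=> sk; elim: p => [r|k' ys|p1 IH1 p2 IH2|p1 IH1 p2 IH2|x b p IHp|xs ys p IHp] //=.
- by move=> /eqP->; rewrite sk /= eqxx.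
- by case/orP=> [/IH1|/IH2] ->; rewrite ?orbT.
- by case/orP=> [/IH1|/IH2] ->; rewrite ?orbT.
Qed.

(** Contrapositively, an assignment that leaves no refinement variable in [c] is defined on every
    one that occurs in [c]. *)
Lemma occurs_subst_None args sigma k c :
  sigma k = None -> occurs k c -> occurs k (subst args sigma c).
Proof.
move=> sk; elim: c => [p|c1 IH1 c2 IH2|x b p c IHc] /=.
- exact: occurs_pred_subst_None.
- by case/orP=> [/IH1|/IH2] ->; rewrite ?orbT.
- by case/orP=> [/(occurs_pred_subst_None args sk)|/IHc] ->; rewrite ?orbT.
Qed.

End Substitution.

(** * Simplification of false operands *)

Section Simplification.
Context {S : signature}.
Implicit Types (G : ctx S) (args : params S) (sigma : partial_assignment S).
Implicit Types (k : kvar) (p q : predicate S) (c : constraint S).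

(** A dropped operand is literally [PFalse]; later proofs need only this, whatever the order of the
    matches in [sor]. *)
Variant sor_spec p q : predicate S -> Prop :=
| SorL of p = PFalse : sor_spec p q q
| SorR of q = PFalse : sor_spec p q p
| SorOr : sor_spec p q (POr p q).

Lemma sorP p q : sor_spec p q (sor p q).
Proof.
case: p => [[]|||||] *; try exact: SorL;
case: q => [[]|||||] *; first [exact: SorR | exact: SorOr].
Qed.

Variant sex_sand_spec x (b : base_type S) p q : predicate S -> Prop :=
| SexFalse of q = PFalse : sex_sand_spec x b p q PFalse
| SexEx : sex_sand_spec x b p q (PEx x b (PAnd p q)).

Lemma sex_sandP x (b : base_type S) p q :
  sex_sand_spec x b p q (sex x b (sand p q)).
Proof. by case: q => [[]|||||] *; first [exact: SexFalse | exact: SexEx]. Qed.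

End Simplification.

(** * The strongest solution and the core of its scope *)

Section Solution.
Context {S : signature} (args : params S) (k : kvar).
Implicit Types (G : ctx S) (sigma : partial_assignment S).
Implicit Types (p q : predicate S) (c d : constraint S).

Lemma occurs_eqs k' (xs ys : seq var) : occurs_pred k' (eqs S xs ys) = false.
Proof. by rewrite /eqs; elim: (zip xs ys). Qed.

Lemma subst_eqs sigma (xs ys : seq var) :
  subst_pred args sigma (eqs S xs ys) = eqs S xs ys.
Proof. by rewrite /eqs; elim: (zip xs ys) => //= xy s ->. Qed.

Lemma wf_eqs G (xs ys : seq var) (bs : seq (base_type S)) :
  map G xs = map Some bs -> map G ys = map Some bs ->
  wf_pred args G (eqs S xs ys).
Proof.
rewrite /eqs; elim: xs ys bs => [|x xs IHxs] [|y ys] [|b bs] //=.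
by move=> [-> /IHxs{}IHxs] [-> /IHxs->]; rewrite eqxx.
Qed.

Lemma holds_eqs (M : structure S) (I : kvar -> seq (univ M) -> Prop)
    (rho : var -> univ M) (xs ys : seq var) :
  size xs = size ys ->
  (holds_pred I rho (eqs S xs ys) <-> map rho xs = map rho ys).
Proof.
rewrite /eqs; elim: xs ys => [|x xs IHxs] [|y ys] //= [/IHxs->].
by split=> [[-> ->]|[-> ->]].
Qed.

Lemma occurs_sol k' c : occurs_pred k' (sol args k c) -> occurs k' c.
Proof.
elim: c => [[]|c1 IH1 c2 IH2|x b p c IHc] //=.
- by move=> k1 ys; case: eqP => //=; rewrite occurs_eqs.
- case: sorP => [_ /IH2->|_ /IH1->|/orP[/IH1|/IH2]->]; by rewrite ?orbT.
- by case: sex_sandP => //= /orP[|/IHc] ->; rewrite ?orbT.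
Qed.

Lemma sol_notin c : ~~ occurs k c -> sol args k c = PFalse.
Proof.
elim: c => [[]|c1 IH1 c2 IH2|x b p c IHc] //=.
- by move=> k1 ys /negbTE->.
- by rewrite negb_or => /andP[/IH1-> /IH2->].
- by rewrite negb_or => /andP[_ /IHc->].
Qed.

(** Only goals that apply [k] contribute a disjunct; the goals dropped by [flatten] are literally
    true and contribute [PFalse]. *)
Lemma sol_not_head c :
  all (fun f => ~~ occurs_pred k (flat_head f)) (Defs.flatten c) ->
  sol args k c = PFalse.
Proof.
elim: c => [[]|c1 IH1 c2 IH2|x b p c IHc] //=.
- by move=> k1 ys; rewrite andbT => /negbTE->.
- by rewrite all_cat => /andP[/IH1-> /IH2->].
- by rewrite all_map => /IHc->.
Qed.

(** Every flat constraint of the implication has [p] in its body, so acyclicity excludes [k] from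
    its head. *)
Lemma sol_acyclic x b p c :
  acyclic k (CAll x b p c) -> occurs_pred k p -> sol args k c = PFalse.
Proof.
move=> acy kp; apply: sol_not_head; move: acy; rewrite /acyclic /= all_map.
by apply: sub_all => f /=; rewrite kp andbT.
Qed.

(** The shapes at which [scope] and [strip_prefix] both stop. The equality also admits a conjunction
    with [k] in neither conjunct, where [scope] stops too. *)
Definition is_core c : bool :=
  match c with
  | CPred _ => true
  | CAnd c1 c2 => occurs k c1 == occurs k c2
  | CAll _ _ p _ => occurs_pred k p
  end.

Definition core c := strip_prefix k (scope k c).

Lemma occurs_core k' c : occurs k' (core c) -> occurs k' c.
Proof.
rewrite /core; elim: c => [p|c1 IH1 c2 IH2|x b p c IHc] //=.
- case: ifP => _; first by move/IH1->.
  by case: ifP => // _ /IH2->; rewrite orbT.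
- by case: ifP => kp /=; rewrite kp // => /IHc->; rewrite orbT.
Qed.

(** * Free variables of the solution and of [sigma k] *)

Section Fixed.
Variables (R : form S -> Prop) (sigma : partial_assignment S) (r : form S).
Hypothesis sigma_k : sigma k = Some (PRef r).
Hypothesis args_uniq : uniq (unzip1 (args k)).

Notation xs := (unzip1 (args k)).

(* [G] collects the binders above the subconstraint [c]. *)
Record located G c : Prop := Located {
  loc_nnf : is_nnf R c;
  loc_wf : wf_constraint args G (subst args sigma c);
  loc_uniq : uniq (binders c);
  loc_fresh : forall x, x \in binders c -> x \notin xs;
  loc_new : forall x, x \in binders c -> G x = None;
  loc_args : forall x, x \in xs -> G x = None }.

Lemma located_andl G c1 c2 : located G (CAnd c1 c2) -> located G c1.
Proof.
case=> [[nnf _] /andP[wf _]] /=; rewrite cat_uniq => /and3P[uq _ _] fresh new args0.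
by split=> // x xc; [apply: fresh | apply: new]; rewrite mem_cat xc.
Qed.

Lemma located_andr G c1 c2 : located G (CAnd c1 c2) -> located G c2.
Proof.
case=> [[_ nnf] /andP[_ wf]] /=; rewrite cat_uniq => /and3P[_ _ uq] fresh new args0.
by split=> // x xc; [apply: fresh | apply: new]; rewrite mem_cat xc orbT.
Qed.

Lemma located_all G x b p c :
  located G (CAll x b p c) -> located (update G x (Some b)) c.
Proof.
case=> [[_ nnf] /andP[_ wf]] /= /andP[x_c uq] fresh new args0.
split=> // y yc; first by apply: fresh; rewrite inE yc orbT.
- rewrite /update; case: eqP => [eq_yx|_]; first by rewrite -eq_yx yc in x_c.
  by apply: new; rewrite inE yc orbT.
- rewrite /update; case: eqP => [eq_yx|_]; last exact: args0.
  by have := fresh x; rewrite inE eqxx -eq_yx yc => /(_ isT).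
Qed.

Lemma located_wf_hyp G x b p c :
  located G (CAll x b p c) ->
  wf_pred args (update G x (Some b)) (subst_pred args sigma p).
Proof. by case=> _ /andP[]. Qed.

Lemma located_sub G x b p c :
  located G (CAll x b p c) -> sub_ctx G (update G x (Some b)).
Proof.
move=> loc y b'; rewrite /update; case: eqP => // ->.
by rewrite (loc_new loc) // inE eqxx.
Qed.

Lemma sub_ctx_args G : (forall x, x \in xs -> G x = None) ->
  sub_ctx G (ctx_params G (args k)).
Proof.
move=> args0 y b Gy; rewrite ctx_params_notin //.
by apply/negP => /args0; rewrite Gy.
Qed.

Lemma ctx_params_update G x b :
  x \notin xs ->
  ctx_params (update G x b) (args k) =1 update (ctx_params G (args k)) x b.
Proof.
move=> x_xs y; rewrite /update; case: eqP => [->|ne_yx].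
  by rewrite ctx_params_notin // eqxx.
by apply: ctx_params_congr => _; case: eqP.
Qed.

Lemma updates_update (U : Type) (rho : var -> U) x u (us : seq U) :
  size us = size xs -> x \notin xs ->
  updates (update rho x u) (zip xs us) =1 update (updates rho (zip xs us)) x u.
Proof.
move=> sz x_xs y; rewrite /update; case: eqP => [->|ne_yx].
  by rewrite updates_notin ?eqxx // unzip1_zip ?sz.
by apply: updates_congr => _; case: eqP.
Qed.

(** A variable bound in [c] becomes existentially bound in the solution, so that only parameters and
    variables of [G] remain free. *)
Lemma wf_sol G c :
  located G c ->
  wf_pred args (ctx_params G (args k)) (subst_pred args sigma (sol args k c)).
Proof.
elim: c G => [[]|c1 IH1 c2 IH2|x b p c IHc] //=.
- move=> k' ys G loc; case: eqP => // eq_k.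
  have := loc_wf loc; rewrite /= eq_k sigma_k /= => /andP[/eqP wf_ys _].
  rewrite subst_eqs; apply: (wf_eqs (bs := unzip2 (args k))).
    exact: map_ctx_params.
  by apply: map_ctx_sub wf_ys; apply: sub_ctx_args; apply: loc_args loc.
- move=> G loc; have := IH1 _ (located_andl loc); have := IH2 _ (located_andr loc).
  by case: sorP => [||] //= -> ->.
- move=> G loc; case: sex_sandP => //=; apply/andP; split.
    apply: wf_pred_sub (located_wf_hyp loc); apply: sub_update.
    by apply: sub_ctx_args; apply: loc_args loc.
  have x_xs : x \notin xs by apply: (loc_fresh loc); rewrite inE eqxx.
  (* The two contexts are only pointwise equal, so inclusion of contexts replaces rewriting. *)
  apply: wf_pred_sub (IHc _ (located_all loc)) => y b'.
  by rewrite ctx_params_update.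
Qed.

(* Every free variable of [sigma k] is a parameter or is bound above each
   occurrence of [k]. *)
Lemma wf_occurrence G c :
  located G c -> occurs k c ->
  exists2 G', wf_form (ctx_params G' (args k)) r &
    forall x, x \notin binders c -> G' x = G x.
Proof.
have occ_pred G' p : wf_pred args G' (subst_pred args sigma p) ->
    is_hyp R p -> occurs_pred k p -> wf_form (ctx_params G' (args k)) r.
  elim: p => [r'|k' ys|p1 IH1 p2 IH2|||] //=.
    by move=> + _ /eqP eq_k; rewrite eq_k sigma_k => /andP[].
  by move=> /andP[wf1 wf2] [hyp1 hyp2] /orP[/IH1|/IH2]; apply.
elim: c G => [p|c1 IH1 c2 IH2|x b p c IHc] G loc /=.
- move=> kp; exists G => //; apply: occ_pred kp; first exact: loc_wf loc.
  by have := loc_nnf loc; case: (p).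
- case/orP=> [/(IH1 _ (located_andl loc))|/(IH2 _ (located_andr loc))] [G' wf_r eqG];
  by exists G' => // x; rewrite mem_cat negb_or => /andP[? ?]; apply: eqG.
- have out y G' : y \notin x :: binders c ->
      (forall z, z \notin binders c -> G' z = update G x (Some b) z) ->
      G' y = G y.
    rewrite inE negb_or => /andP[ne_yx y_c] ->//.
    by rewrite /update (negbTE ne_yx).
  case/orP=> [kp|/(IHc _ (located_all loc))[G' wf_r eqG]]; last first.
    by exists G' => // y /out; apply.
  exists (update G x (Some b)); last by move=> y /out; apply.
  by apply: occ_pred kp; [apply: located_wf_hyp loc|case: (loc_nnf loc)].
Qed.

Lemma wf_core G c :
  located G c -> is_core c -> acyclic k c ->
  sol args k c = PFalse \/ wf_form (ctx_params G (args k)) r.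
Proof.
case: c => [p|c1 c2|x b p c] loc core_c acy; last first.
- by left; rewrite /= (sol_acyclic acy core_c).
- have [k_c1|nk_c1] := boolP (occurs k c1); last first.
    left; rewrite /= !sol_notin //; move: core_c nk_c1 => /=.
    by case: (occurs k c1); case: (occurs k c2).
  have k_c2 : occurs k c2 by rewrite -(eqP core_c).
  have [G1 wf1 eq1] := wf_occurrence (located_andl loc) k_c1.
  have [G2 wf2 eq2] := wf_occurrence (located_andr loc) k_c2.
  (* [G1] and [G2] differ from [G] only on the binders of [c1] and of [c2] respectively. These are
     disjoint and absent from [G], so a non-parameter declared in both has its sort from [G]. *)
  right; apply: wf_form_meet wf1 wf2 => y b1 b2.
  have [y_xs|y_xs] := boolP (y \in xs).
    by rewrite (ctx_params_congr (G' := G)) // y_xs.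
  rewrite !ctx_params_notin //.
  have [y_c1|/eq1-> //] := boolP (y \in binders c1).
  have [y_c2|/eq2->] := boolP (y \in binders c2).
    have := loc_uniq loc; rewrite /= cat_uniq => /and3P[_ /hasPn/(_ y y_c2)].
    by rewrite /= y_c1.
  by rewrite (loc_new (located_andl loc)).
- have [kp|nkp] := boolP (occurs_pred k p); last first.
    by left; apply: (@sol_notin (CPred p)).
  (* A leaf has no binders, so the context at the occurrence is [G] itself. *)
  right; have [G' + eqG] := wf_occurrence loc kp.
  by apply: wf_form_sub => y b; rewrite (ctx_params_congr (G' := G)) // => _; apply: eqG.
Qed.

(** * The solution entails [sigma k] *)

Section Semantics.
Variables (M : structure S) (I : kvar -> seq (univ M) -> Prop).
Implicit Types (rho : var -> univ M) (us : seq (univ M)).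

Notation bind rho us := (updates rho (zip xs us)).

Lemma map_bind rho us : size us = size xs -> map (bind rho us) xs = us.
Proof. exact: map_updates_zip. Qed.

Lemma agree_bind G rho us :
  (forall x, x \in xs -> G x = None) -> size us = size xs ->
  agree G rho (bind rho us).
Proof.
move=> args0 sz y Gy; rewrite updates_notin // unzip1_zip ?sz //.
by apply/negP => /args0 Gy0; rewrite Gy0 in Gy.
Qed.

Lemma agree_params G rho rho' :
  agree G rho rho' -> map rho xs = map rho' xs ->
  agree (ctx_params G (args k)) rho rho'.
Proof.
move=> eq_rho /eq_in_map eq_xs y Gy.
have [/eq_xs //|y_xs] := boolP (y \in xs).
by apply: eq_rho; rewrite ctx_params_notin in Gy.
Qed.

Lemma wf_app_size G (ys : seq var) :
  wf_pred args G (subst_pred args sigma (PApp k ys)) ->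
  [/\ map G ys = map Some (unzip2 (args k)), size xs = size ys
    & forall rho, size (map rho ys) = size xs].
Proof.
rewrite /= sigma_k => /andP[/eqP wf_ys _].
have sz : size xs = size ys by rewrite -[RHS](size_map G) wf_ys !size_map.
by split=> // rho; rewrite size_map sz.
Qed.

(* [wf_r] keeps [r] from mentioning variables bound in [c]; this is what lets
   its truth move from a goal [k ys] in [c] to the environment [rho']. *)
Lemma sol_strongest G0 G c rho rho' :
  located G c -> sub_ctx G0 G -> wf_form (ctx_params G0 (args k)) r ->
  agree G rho rho' -> holds I rho (subst args sigma c) ->
  holds_pred I rho' (subst_pred args sigma (sol args k c)) ->
  holds_form rho' r.
Proof.
move=> + + wf_r.
elim: c G rho rho' => [[]|c1 IH1 c2 IH2|x b p c IHc] //=.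
- move=> k' ys G rho rho' loc sG eq_rho; case: eqP => // eq_k.
  have [] := wf_app_size (G := G) (ys := ys).
    by have := loc_wf loc; rewrite /= eq_k.
  move=> wf_ys sz szm; rewrite eq_k sigma_k subst_eqs /= => r_rho.
  (* The equations give the parameters the same values in [rho'] as the [PLet] does at the goal, so
     both environments agree on all that [r] can mention. *)
  move/holds_eqs => /(_ sz) eq_xs; apply: (holds_form_agree _ wf_r).1 r_rho.
  apply: agree_params; last by rewrite map_bind // eq_xs (agree_map eq_rho wf_ys).
  move=> y G0y; have {}eq_rho := agree_sub sG eq_rho.
  rewrite -(eq_rho y) //; apply/esym; apply: agree_bind (G0y) => // z z_xs.
  by case G0z: (G0 z) => [b|] //; move: (sG _ _ G0z); rewrite (loc_args loc).
- move=> G rho rho' loc sG eq_rho [holds1 holds2].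
  have := IH1 _ _ _ (located_andl loc) sG eq_rho holds1.
  have := IH2 _ _ _ (located_andr loc) sG eq_rho holds2.
  by case: sorP => //= [] IH IH' [].
- move=> G rho rho' loc sG eq_rho hc; case: sex_sandP => //= [[u bu [hp hsol]]].
  have eq_rho1 := @agree_update _ _ _ _ _ x b u eq_rho.
  (* The hypothesis recorded in the solution discharges the one in the implication that holds under
     [sigma]. *)
  have hp' := (holds_pred_agree I eq_rho1 (located_wf_hyp loc)).2 hp.
  have sG1 : sub_ctx G0 (update G x (Some b)).
    by move=> y b' /sG; exact: (located_sub loc).
  have r_u := IHc _ _ _ (located_all loc) sG1 eq_rho1 (hc u bu hp') hsol.
  (* [x] is neither a parameter nor declared in [G0], so [r] does not see the witness [u]. *)
  apply: (holds_form_agree _ wf_r).1 r_u => y; rewrite /update.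
  case: (y =P x) => // ->; rewrite ctx_params_notin.
    case G0x: (G0 x) => [b'|] //; have := sG _ _ G0x.
    by rewrite (loc_new loc) // inE eqxx.
  by apply: (loc_fresh loc); rewrite inE eqxx.
Qed.

End Semantics.

(** * Replacing [sigma k] by the solution *)

Variables (q : predicate S) (sigma' : partial_assignment S).
Hypothesis sigma'_k : sigma' k = Some q.
Hypothesis sigma'_neq : forall k', k' != k -> sigma' k' = sigma k'.

Lemma subst_notin c :
  ~~ occurs k c -> subst args sigma' c = subst args sigma c.
Proof.
move=> nkc; apply: eq_subst => k' k'c; apply: sigma'_neq.
by apply: contraNneq nkc => <-.
Qed.

Lemma subst_pred_notin p :
  ~~ occurs_pred k p -> subst_pred args sigma' p = subst_pred args sigma p.
Proof.
move=> nkp; apply: eq_subst_pred => k' k'p; apply: sigma'_neq.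
by apply: contraNneq nkp => <-.
Qed.

Lemma wf_subst_hyp G0 G p :
  wf_pred args (ctx_params G0 (args k)) q -> sub_ctx G0 G -> is_hyp R p ->
  wf_pred args G (subst_pred args sigma p) ->
  wf_pred args G (subst_pred args sigma' p).
Proof.
move=> wf_q sG; elim: p => [r'|k' ys|p1 IH1 p2 IH2|||] //=.
- case: (k' =P k) => [->|/eqP/sigma'_neq->//] _.
  rewrite sigma_k sigma'_k => /= /andP[-> _] /=.
  by apply: wf_pred_sub wf_q; apply: sub_ctx_params.
- by move=> [hyp1 hyp2] /andP[wf1 wf2]; rewrite IH1 ?IH2.
Qed.

Lemma is_goal_hyp p : is_goal R p -> is_hyp R p.
Proof. by case: p. Qed.

Lemma wf_subst G0 G c :
  wf_pred args (ctx_params G0 (args k)) q -> sub_ctx G0 G -> located G c ->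
  wf_constraint args G (subst args sigma' c).
Proof.
move=> wf_q; elim: c G => [p|c1 IH1 c2 IH2|x b p c IHc] G sG loc /=.
- apply: wf_subst_hyp wf_q sG _ (loc_wf loc).
  by apply: is_goal_hyp; apply: loc_nnf loc.
- by rewrite IH1 ?IH2 //; [apply: located_andr loc|apply: located_andl loc].
- have sG1 : sub_ctx G0 (update G x (Some b)).
    by move=> y b' /sG; exact: (located_sub loc).
  rewrite (IHc _ sG1 (located_all loc)) andbT.
  apply: wf_subst_hyp wf_q sG1 _ (located_wf_hyp loc).
  by case: (loc_nnf loc).
Qed.

Section Solves.
Variables (M : structure S) (I : kvar -> seq (univ M) -> Prop).
Variables (G0 : ctx S) (rho0 : var -> univ M).
Implicit Types (rho : var -> univ M) (us : seq (univ M)).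
Hypothesis wf_q : wf_pred args (ctx_params G0 (args k)) q.

Notation bind rho us := (updates rho (zip xs us)).

(** The comparison of [q] with [r] is needed at every environment reached below the core, and such
    an environment is only known to share with [rho0] the values on [G0]. *)
Hypothesis q_strongest : forall rho us,
  agree G0 rho0 rho -> size us = size xs ->
  holds_pred I (bind rho us) q -> holds_form (bind rho us) r.

(** Hypotheses are built by conjunction only, hence are monotone in [k], and [q] entails [r]. *)
Lemma holds_subst_hyp G rho p :
  agree G0 rho0 rho -> is_hyp R p ->
  wf_pred args G (subst_pred args sigma p) ->
  holds_pred I rho (subst_pred args sigma' p) ->
  holds_pred I rho (subst_pred args sigma p).
Proof.
move=> eq_rho; elim: p => [r'|k' ys|p1 IH1 p2 IH2|||] //=.
- case: (k' =P k) => [->|/eqP/sigma'_neq->//] _ wf_ys.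
  have [_ _ sz] := wf_app_size M wf_ys.
  by rewrite sigma_k sigma'_k; apply: q_strongest.
- by move=> [hyp1 hyp2] /andP[wf1 wf2] [/IH1{}IH1 /IH2{}IH2]; split; auto.
Qed.

(* The third premise records that the hypotheses on the path from the core
   down to [c] hold. *)
Lemma holds_subst G rho c :
  located G c -> sub_ctx G0 G ->
  (forall us, size us = size xs ->
     holds_pred I (bind rho us) (subst_pred args sigma (sol args k c)) ->
     holds_pred I (bind rho us) q) ->
  agree G0 rho0 rho ->
  holds I rho (subst args sigma c) -> holds I rho (subst args sigma' c).
Proof.
elim: c G rho => [p|c1 IH1 c2 IH2|x b p c IHc] G rho loc sG sol_q eq_rho /=.
- case: p loc sol_q => // [k' ys|? ?|? ?|? ? ?|? ? ?] loc sol_q;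
    try by case: (loc_nnf loc).
  case: (k' =P k) => [eq_k|/eqP nk]; last by rewrite /= sigma'_neq.
  rewrite eq_k in loc sol_q *; have [wf_ys sz szm] := wf_app_size M (loc_wf loc).
  (* The solution of the goal [k ys] is the conjunction of the equations [xs = ys], true once the
     parameters are bound to the values of [ys]. *)
  rewrite /= sigma'_k => _; apply: sol_q; rewrite //= eqxx subst_eqs.
  apply/holds_eqs; rewrite // map_bind //.
  apply: agree_map wf_ys; apply: agree_bind => //.
  exact: loc_args loc.
- move=> [h1 h2]; split.
    (* The solution of one conjunct is a disjunct of the whole; if simplification removed it, it was
       false. *)
    apply: IH1 (located_andl loc) sG _ eq_rho h1 => us sz hsol.
    by apply: sol_q => //=; move: hsol; case: sorP => //= [-> |] ; auto.
  apply: IH2 (located_andr loc) sG _ eq_rho h2 => us sz hsol.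
  by apply: sol_q => //=; move: hsol; case: sorP => //= [-> |] ; auto.
- move=> hc u bu hp'.
  have x_xs : x \notin xs by apply: (loc_fresh loc); rewrite inE eqxx.
  have G0x : G0 x = None.
    case G0x: (G0 x) => [b'|] //; have := sG _ _ G0x.
    by rewrite (loc_new loc) // inE eqxx.
  have eq_rho1 : agree G0 rho0 (update rho x u).
    move=> y G0y; rewrite /update; case: (y =P x) G0y => [->|_ /eq_rho //].
    by rewrite G0x.
  have wf_p := located_wf_hyp loc.
  have hyp_p : is_hyp R p by case: (loc_nnf loc).
  have hp := holds_subst_hyp eq_rho1 hyp_p wf_p hp'.
  have sG1 : sub_ctx G0 (update G x (Some b)).
    by move=> y b' /sG; exact: (located_sub loc).
  apply: IHc (located_all loc) sG1 _ eq_rho1 (hc u bu hp) => us sz hsol.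
  have bindE := updates_update rho u sz x_xs.
  have hq : holds_pred I (bind rho us) q.
    apply: sol_q => //=; case: sex_sandP => [sol0|]; first by rewrite sol0 in hsol.
    (* The value of the universally bound [x] witnesses the existential of the solution, and [hp]
       supplies the conjunct for the hypothesis. *)
    exists u => //; split.
      apply: (holds_pred_agree I _ wf_p).1 hp => y Gy.
      rewrite -bindE; apply: agree_bind (Gy) => //.
      exact: loc_args (located_all loc).
    by apply: (holds_pred_agree I _ (wf_sol (located_all loc))).1 hsol => y _.
  (* [q] is formed over [G0] and the parameters, and [x] is in neither, so [q] stays true after [x]
     is set to [u]. *)
  apply: (holds_pred_agree I _ wf_q).1 hq => y Gy.
  rewrite bindE /update; case: (y =P x) Gy => // ->.
  by rewrite ctx_params_notin // G0x.
Qed.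

End Solves.

(** An implication at each environment, since a subconstraint under hypotheses need not be valid
    alone. *)
Definition solves_at G c : Prop :=
  wf_constraint args G (subst args sigma' c) /\
  forall (M : structure S) (I : kvar -> seq (univ M) -> Prop)
    (rho : var -> univ M),
    holds I rho (subst args sigma c) -> holds I rho (subst args sigma' c).

Lemma solves_core G c :
  located G c -> is_core c -> acyclic k c ->
  q = subst_pred args sigma (sol args k c) -> solves_at G c.
Proof.
move=> loc core_c acy q_sol.
have wf_q : wf_pred args (ctx_params G (args k)) q by rewrite q_sol; apply: wf_sol.
split=> [|M I rho hc]; first exact: wf_subst wf_q _ loc.
apply: (holds_subst wf_q _ loc _ _ _ hc) => //; last by rewrite q_sol.
move=> rho1 us eq_rho sz.
(* A false solution entails anything; otherwise [r] is well-sorted over [G], and the truth of [c]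
   under [sigma] at [rho] yields it. *)
rewrite q_sol; case: (wf_core loc core_c acy) => [-> //|wf_r].
apply: sol_strongest (loc) _ wf_r _ hc => //.
move=> y Gy; rewrite (eq_rho y Gy); apply: agree_bind Gy => //.
exact: loc_args loc.
Qed.

(** Outside its core, [c] has no [k], so [sigma] and [sigma'] agree there. The core is in goal
    position, hence the implication passes through the enclosing conjunctions and implications. *)
Lemma solves_scope G c :
  located G c -> acyclic k c ->
  q = subst_pred args sigma (sol args k (core c)) -> solves_at G c.
Proof.
elim: c G => [p|c1 IH1 c2 IH2|x b p c IHc] G loc acy.
- exact: solves_core.
- rewrite /core /=.
  move: (acy); rewrite {1}/acyclic /= all_cat => /andP[acy1 acy2].
  have [/andP[k1 k2]|] := ifPn.
    move/(IH1 _ (located_andl loc) acy1) => [wf1 h1].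
    split=> [|M I rho] /=; rewrite (subst_notin k2).
      by rewrite wf1; case/andP: (loc_wf loc).
    by move=> [/h1].
  move=> n1; have [/andP[k1 k2]|n2] := ifPn.
    move/(IH2 _ (located_andr loc) acy2) => [wf2 h2].
    split=> [|M I rho] /=; rewrite (subst_notin k1).
      by rewrite wf2; move: (loc_wf loc) => /= /andP[->].
    by move=> [? /h2].
  apply: solves_core => //=; move: n1 n2.
  by case: (occurs k c1); case: (occurs k c2).
- rewrite /core /=; have [kp /=|nkp] := ifPn; first by rewrite kp; apply: solves_core.
  rewrite /= (negbTE nkp); move: acy; rewrite /acyclic /= all_map => acy.
  have {}acy : acyclic k c.
    by apply: sub_all acy => f /=; rewrite (negbTE nkp).
  move/(IHc _ (located_all loc) acy) => [wf_c hc].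
  split=> [|M I rho] /=; rewrite (subst_pred_notin nkp).
    by rewrite wf_c; move: (loc_wf loc) => /= /andP[->].
  by move=> hp u bu /(hp u bu)/hc.
Qed.

End Fixed.
End Solution.

(** * Satisfaction of the whole constraint *)

Theorem theorem5p6 (S : signature) (T : theory S)
    (R : form S -> Prop) (hR : refinement_set R)
    (args : params S) (hargs : wf_params args)
    (c : constraint S) (hc : nnf_constraint R args c)
    (k : kvar) (hk : acyclic k c)
    (sigma : partial_assignment S) (hsigma : is_assignment R sigma) :
  satisfies T args sigma c ->
  satisfies T args
    (comp_assignment args sigma (strongest_scoped_solution args c k)) c.
Proof.
set sol_k := strongest_scoped_solution args c k.
set sigma' := comp_assignment args sigma sol_k.
move=> [closed wf_c valid_c].
pose q := subst_pred args sigma (sol args k (core k c)).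
have sigma'_k : sigma' k = Some q.
  by rewrite /sigma' /comp_assignment /sol_k /strongest_scoped_solution eqxx.
have sigma'_neq k' : k' != k -> sigma' k' = sigma k'.
  by rewrite /sigma' /comp_assignment /sol_k /strongest_scoped_solution => /negbTE->.
have defined k' : occurs k' c -> exists r, sigma k' = Some (PRef r).
  case sk: (sigma k') => [p|] k'c; first by have [r _ ->] := hsigma _ _ sk; exists r.
  by case/negP: (closed k'); apply: occurs_subst_None.
(* If [k] does not occur, [sigma k] may be undefined, but then [sigma] and [sigma'] agree on [c]. *)
have [kc|nkc] := boolP (occurs k c); last first.
  by rewrite /satisfies (subst_notin args sigma'_neq nkc).
have [r sigma_k] := defined k kc.
have loc : located args k R sigma empty_ctx c.
  by split=> //; [apply: nnf_grammar hc|apply: nnf_uniq hc|exact: (nnf_fresh hc)].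
have [wf_c' solves] :=
  solves_scope sigma_k (hargs.1 k) sigma'_k sigma'_neq loc hk erefl.
split=> //; last by move=> M TM I rho; apply/solves/valid_c.
(* Every refinement variable of the solution occurs in [c], so [sigma] maps it to a refinement. *)
have closed_q k' : ~~ occurs_pred k' q.
  apply/negP => /occurs_pred_subst[k2 /occurs_sol/occurs_core/defined[r2 ->]].
  by [].
move=> k'; apply/negP => /occurs_subst[k2 k2c].
case: (k2 =P k) => [->|/eqP/sigma'_neq->].
  by rewrite sigma'_k; apply/negP.
by have [r2 ->] := defined _ k2c.
Qed.
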